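(* Let $p<q<r$ be odd primes such that $r=\alpha p+\beta q\le\varphi(pq)$ for some integers $\alpha,\beta>0$. Let $p'\in\{1,2,\ldots,q-1\}$ be the inverse of $p$ modulo $q$ and let $q'\in\{1,2,\ldots,p-1\}$ be the inverse of $q$ modulo $p$. Then $\Psi_{pqr}$ is flat if and only if at least one of the following conditions holds: (a) $\alpha\ge\max\{p',q-p'\}$; (b) $\beta\ge\max\{q',p-q'\}$; (c) $\alpha\ge p'$ and $\beta\ge p-q'$; (d) $\alpha\ge q-p'$ and $\beta\ge q'$.
   Context: $\varphi$ is Euler's totient function. $\Phi_n$ is the $n$th cyclotomic polynomial, and the $n$th inverse cyclotomic polynomial is $\Psi_n(x)=\dfrac{x^n-1}{\Phi_n(x)}$. The height of a polynomial is the maximal absolute value of its coefficients. A polynomial is called flat if its height equals $1$. *)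

(* Defs.v *)
From mathcomp Require Import all_boot all_order all_algebra all_field.

Set Implicit Arguments.
Unset Strict Implicit.
Unset Printing Implicit Defensive.

Import GRing.Theory.
Local Open Scope ring_scope.

(* 'Phi_n is monic and, for n > 0, divides 'X^n - 1, so that the
   pseudo-division %/ of {poly int} is the exact quotient here. *)
Definition inverse_cyclotomic (n : nat) : {poly int} := ('X^n - 1) %/ 'Phi_n.

Definition height (f : {poly int}) : nat :=
  (\max_(i < size f) `|(f`_i)%R|)%N.

Definition flat (f : {poly int}) : Prop := height f = 1%N.

(* Main.v *)
(** Cancelling cyclotomic factors gives
      Psi_pqr (X^p - 1) (X^q - 1) (X^r - 1)
        = (X - 1) (X^pq - 1) (X^pr - 1) (X^qr - 1).
    Let S be the semigroup generated by p and q, and K(n) the number of k with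
    n - r k in S.  As r is in S, these k form an initial segment, and expanding
    1 / ((1 - X^p) (1 - X^q)) over S shows that the n-th coefficient of Psi_pqr
    is D(n - 1) - D(n) with D(-1) = 0 and, in truncated subtraction,
    D(n) = min(q, K(n)) - min(q, K(n) - p), which is 1-Lipschitz in K(n).
    Since 1 = p' p - (p - q') q = q' q - (q - p') p, having p' <= alpha or
    q' <= beta implies K(n) <= K(n - 1) + 1, and having q - p' <= alpha or
    p - q' <= beta implies K(n - 1) <= K(n) + 1; if both hold, Psi_pqr is flat.
    If the first fails then r - 1 is not in S, so D(r - 1) = 0 while D(r) = 2;
    if the second fails the same happens at r + 1. *)

Require Import Defs.
From mathcomp Require Import all_boot all_order all_algebra all_field.
From mathcomp Require Import zify ring.

Set Implicit Arguments.
Unset Strict Implicit.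
Unset Printing Implicit Defensive.

Import GRing.Theory Num.Theory.
Local Open Scope ring_scope.

(** * Factorization into cyclotomic polynomials *)

Lemma prod_divisors_mulp (R : comPzRingType) (f : nat -> R) n p :
    prime p -> (0 < n)%N -> ~~ (p %| n)%N ->
  \prod_(d <- divisors (n * p)) f d =
  \prod_(d <- divisors n) f d * \prod_(d <- divisors n) f (d * p)%N.
Proof.
move=> p_pr n_gt0 pNn; have p_gt0 := prime_gt0 p_pr.
have np_gt0 : (0 < n * p)%N by rewrite muln_gt0 n_gt0.
rewrite -[X in _ * X](big_map (muln^~ p) xpredT f) -big_cat /=.
apply: perm_big; apply: uniq_perm; first exact: divisors_uniq.
  rewrite cat_uniq map_inj_uniq ?divisors_uniq /= => [|a b /eqP]; last first.
    by rewrite eqn_pmul2r // => /eqP.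
  rewrite andbT; apply/hasPn => _ /mapP[d _ ->].
  rewrite /= -dvdn_divisors //; apply: contra pNn.
  exact/dvdn_trans/dvdn_mull.
move=> d; rewrite mem_cat -!dvdn_divisors //.
apply/idP/orP => [dnp|[dn|/mapP[e]]]; last 2 first.
- exact: dvdn_mulr.
- by rewrite -dvdn_divisors // => en ->; rewrite dvdn_pmul2r.
have [/dvdnP[e def_d]|pNd] := boolP (p %| d)%N.
  right; apply/mapP; exists e => //.
  by rewrite -dvdn_divisors // -(dvdn_pmul2r p_gt0) -def_d.
left; rewrite -(@Gauss_dvdl _ _ p) //.
by rewrite coprime_sym prime_coprime.
Qed.

Lemma inverse_cyclotomicE n : (0 < n)%N ->
  inverse_cyclotomic n * 'Phi_n = 'X^n - 1.
Proof.
move=> n_gt0; rewrite /inverse_cyclotomic -prod_Cyclotomic //.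
rewrite (bigD1_seq n) ?divisors_id ?divisors_uniq //=.
by rewrite Pdiv.IdomainMonic.mulKp ?Cyclotomic_monic // mulrC.
Qed.

(** After multiplication by ['Phi_(p * q * r)] both sides are the same product: ['Phi_1] four times,
    the factors of the three primes twice, the others once. *)
Lemma inverse_cyclotomic_pqr p q r : prime p -> prime q -> prime r ->
    p != q -> p != r -> q != r ->
  inverse_cyclotomic (p * q * r) * (('X^p - 1) * ('X^q - 1) * ('X^r - 1)) =
  ('X - 1) * ('X^(p * q) - 1) * ('X^(p * r) - 1) * ('X^(q * r) - 1).
Proof.
move=> p_pr q_pr r_pr pq pr qr.
have p_gt0 := prime_gt0 p_pr; have q_gt0 := prime_gt0 q_pr.
have r_gt0 := prime_gt0 r_pr.
have pNq : ~~ (q %| p)%N by rewrite dvdn_prime2 // eq_sym.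
have pNr : ~~ (r %| p)%N by rewrite dvdn_prime2 // eq_sym.
have qNr : ~~ (r %| q)%N by rewrite dvdn_prime2 // eq_sym.
have pqNr : ~~ (r %| p * q)%N by rewrite Euclid_dvdM // negb_or pNr.
have prod_divisors_prime a f : prime a ->
    \prod_(d <- divisors a) f d = f 1%N * f a :> {poly int}.
  move=> a_pr; rewrite -{1}[a]mul1n prod_divisors_mulp //.
    by rewrite !big_seq1 mul1n.
  by rewrite dvdn1 neq_ltn prime_gt1 ?orbT.
have E1 : 'X - 1 = 'Phi_1 :> {poly int}.
  by rewrite -['X]expr1 -prod_Cyclotomic // big_seq1.
have Ep a : prime a -> 'X^a - 1 = 'Phi_1 * 'Phi_a :> {poly int}.
  by move=> a_pr; rewrite -prod_Cyclotomic ?prime_gt0 // prod_divisors_prime.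
have Epq a b : prime a -> prime b -> ~~ (b %| a)%N ->
   'X^(a * b) - 1 = 'Phi_1 * 'Phi_a * ('Phi_b * 'Phi_(a * b)) :> {poly int}.
  move=> a_pr b_pr bNa; have a_gt0 := prime_gt0 a_pr.
  rewrite -prod_Cyclotomic ?muln_gt0 ?a_gt0 ?prime_gt0 //.
  rewrite prod_divisors_mulp // prod_Cyclotomic // Ep //.
  by rewrite prod_divisors_prime // mul1n.
apply: (mulIf (monic_neq0 (Cyclotomic_monic (p * q * r)))).
rewrite mulrAC inverse_cyclotomicE ?muln_gt0 ?p_gt0 ?q_gt0 //.
rewrite -prod_Cyclotomic ?muln_gt0 ?p_gt0 ?q_gt0 //.
rewrite prod_divisors_mulp // ?muln_gt0 ?p_gt0 //.
rewrite prod_Cyclotomic ?muln_gt0 ?p_gt0 //.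
rewrite prod_divisors_mulp //.
rewrite !prod_divisors_prime // !mul1n E1 !Epq // !Ep //.
ring.
Qed.

(** * The semigroup generated by [p] and [q] *)

(* With j < p, the representation of n is unique when p and q are coprime. *)
Definition in_semigroup (p q n : nat) : bool :=
  [exists j : 'I_p, (q * j <= n) && (p %| n - q * j)]%N.

Lemma in_semigroupP p q n : (0 < p)%N ->
  reflect (exists a b, n = a * p + b * q)%N (in_semigroup p q n).
Proof.
move=> p_gt0; apply: (iffP existsP) => [[j /andP[le_n]]|[a [b ->]]].
  case/dvdnP=> a na; exists a, (val j).
  by rewrite -na [(_ * q)%N]mulnC subnK.
(* Reducing [b] modulo [p] moves a multiple of [p * q] into the [p] part. *)
exists (Ordinal (ltn_pmod b p_gt0)) => /=.
have -> : (a * p + b * q = (a + b %/ p * q) * p + q * (b %% p))%N.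
  by rewrite {1}(divn_eq b p); ring.
by rewrite leq_addl addnK dvdn_mull.
Qed.

(** Two admissible [j] are congruent modulo [p], hence equal. *)
Lemma sum_in_semigroup p q n : coprime p q ->
  (\sum_(j < p) ((q * j <= n) && (p %| n - q * j)) = in_semigroup p q n)%N.
Proof.
move=> cpq; case: (boolP (in_semigroup p q n)) => [/existsP[j /andP[jn pj]]|].
  rewrite (bigD1 j) //= jn pj big1 ?addn0 // => i ij.
  apply/eqP; rewrite eqb0; apply: contra ij => /andP[in_ pi].
  wlog le_ij : i j jn pj in_ pi / (i <= j)%N => [IH|].
    by case/orP: (leq_total i j) => /IH; [apply | rewrite eq_sym; apply].
  have: (p %| q * (j - i))%N.
    rewrite mulnBr -(dvdn_addr _ pj) addnBA ?leq_mul2l ?le_ij ?orbT //.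
    by rewrite subnK.
  rewrite Gauss_dvdr // -eqn_mod_dvd // !modn_small // => /eqP ji.
  exact/eqP/val_inj.
rewrite negb_exists => /forallP nj.
by rewrite big1 // => j _; rewrite (negbTE (nj j)).
Qed.

(** * Coefficients of the inverse cyclotomic polynomial *)

(** Without the guard, a negative n - r k would truncate to 0, which lies in the semigroup. *)
Definition shifted_mem (p q r n k : nat) : bool :=
  ((r * k <= n) && in_semigroup p q (n - r * k))%N.

(* D(n) of the header. *)
Definition excess (p q r n : nat) : int :=
  \sum_(k < q) (shifted_mem p q r n k)%:R -
  \sum_(k < q) (shifted_mem p q r n (k + p))%:R.

(** The finite sum stands in for 1 / (1 - X^p), exactly below degree [p * M]. *)
Lemma coef_geometric p M n : (0 < p)%N -> (n < p * M)%N ->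
  (\sum_(i < M) 'X^p ^+ i : {poly int})`_n = (p %| n)%:R.
Proof.
move=> p_gt0 nM; rewrite coef_sum.
under eq_bigr => i _ do rewrite -exprM coefXn.
have [/dvdnP[i def_n]|pNn] := boolP (p %| n)%N.
  have iM : (i < M)%N by rewrite -(ltn_pmul2l p_gt0) mulnC -def_n.
  rewrite (bigD1 (Ordinal iM)) //= def_n mulnC eqxx big1 ?addr0 // => j ij.
  rewrite eqn_pmul2l //; case: eqP => // ji.
  by case/eqP: ij; apply: val_inj.
rewrite big1 // => i _; case: eqP => // def_n.
by rewrite def_n dvdn_mulr in pNn.
Qed.

Lemma coef_geometric3 p q r M n : (0 < p)%N -> coprime p q -> (n < p * M)%N ->
  ((\sum_(k < q) 'X^r ^+ k) *
    ((\sum_(j < p) 'X^q ^+ j) * \sum_(i < M) 'X^p ^+ i) : {poly int})`_n =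
  \sum_(k < q) (shifted_mem p q r n k)%:R.
Proof.
move=> p_gt0 cpq nM; rewrite big_distrl coef_sum /=; apply: eq_bigr => k _.
rewrite -exprM coefXnM /shifted_mem [(_ <= n)%N]leqNgt; case: ltnP => //= rk_n.
rewrite big_distrl coef_sum /= -sum_in_semigroup // natr_sum.
apply: eq_bigr => j _; rewrite -exprM coefXnM [(q * j <= _)%N]leqNgt.
case: ltnP => //= qj_n.
by rewrite coef_geometric //; apply: leq_ltn_trans nM; rewrite -subnDA leq_subr.
Qed.

Lemma coef_inverse_cyclotomic_pqr p q r n : prime p -> prime q -> prime r ->
    p != q -> p != r -> q != r ->
  (inverse_cyclotomic (p * q * r))`_n =
  (if n == 0 then 0 else excess p q r n.-1) - excess p q r n.
Proof.
move=> p_pr q_pr r_pr pq pr qr; have p_gt0 := prime_gt0 p_pr.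
have cpq : coprime p q by rewrite prime_coprime // dvdn_prime2.
(* As [p * M > n], the factor ['X^(p * M) - 1] acts as -1 on coefficients up to [n]; this avoids
   power series. *)
pose M := n.+1; have nM : (n < p * M)%N by rewrite leq_pmull.
pose P : {poly int} := (\sum_(k < q) 'X^r ^+ k) *
    ((\sum_(j < p) 'X^q ^+ j) * \sum_(i < M) 'X^p ^+ i).
have PsiE : inverse_cyclotomic (p * q * r) * ('X^(p * M) - 1) =
   ('X - 1) * (('X^(p * r) - 1) * P).
  have nz : (('X^p - 1) * ('X^q - 1) * ('X^r - 1) : {poly int}) != 0.
    by rewrite !mulf_neq0 // monic_neq0 // monicXnsubC ?prime_gt0.
  apply: (mulIf nz); rewrite mulrAC inverse_cyclotomic_pqr //.
  rewrite [(p * q)%N]mulnC [(q * r)%N]mulnC !(exprM _ _ q) !(exprM _ _ M).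
  rewrite (exprM _ q p) (subrX1 'X^r q) (subrX1 'X^p M) (subrX1 'X^q p).
  rewrite /P; ring.
have coefP m : (m <= n)%N ->
    P`_m = \sum_(k < q) (shifted_mem p q r m k)%:R.
  by move=> le_mn; rewrite coef_geometric3 // (leq_ltn_trans le_mn nM).
(* Multiplication by ['X^(p * r)] replaces [k] by [k + p], since r k + p r = r (k + p). *)
have coefXP m : (m <= n)%N -> (('X^(p * r) - 1) * P)`_m = - excess p q r m.
  move=> le_mn; rewrite mulrBl mul1r coefB coefXnM (coefP m) //.
  rewrite /excess opprB; congr (_ - _).
  case: ltnP => [lt_m|le_m].
    rewrite big1 // => k _; rewrite /shifted_mem leqNgt (leq_trans lt_m) //.
    by rewrite [leqRHS]mulnC leq_mul2r leq_addl orbT.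
  rewrite coefP; last by rewrite (leq_trans _ le_mn) ?leq_subr.
  apply: eq_bigr => k _; rewrite /shifted_mem mulnDr [(r * p)%N]mulnC addnC.
  by rewrite leq_subRL // subnDA.
have := congr1 (fun f : {poly int} => f`_n) PsiE.
rewrite mulrBr mulr1 coefB coefMXn nM sub0r mulrBl mul1r coefB coefXM.
rewrite (coefXP n) // coefXP ?leq_pred // => /(congr1 -%R); rewrite opprK => ->.
by case: ifP; rewrite ?sub0r !opprB ?opprK ?subr0 ?sub0r // addrC.
Qed.

(** * The threshold K(n) and its variation *)

Lemma shifted_memP p q r n k : (0 < p)%N ->
  reflect (exists a b, n = r * k + a * p + b * q)%N (shifted_mem p q r n k).
Proof.
move=> p_gt0; apply: (iffP andP) => [[le_rk /in_semigroupP[]// a [b nE]]|].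
  by exists a, b; rewrite -addnA -nE subnKC.
move=> [a [b ->]]; rewrite -addnA leq_addr addKn; split=> //.
by apply/in_semigroupP => //; exists a, b.
Qed.

(** Passing from [k.+1] to [k] frees one [r], that is, [alpha] copies of [p] and [beta] of [q].
    Exchanging [x] of these [p] for [y] copies of [q], or [y] of these [q] for [x] copies of [p],
    turns [n] into [m]. *)
Lemma shifted_mem_step p q alpha beta x y m n k : (0 < p)%N ->
    (x <= alpha)%N /\ (m + x * p = n + y * q)%N \/
    (y <= beta)%N /\ (m + y * q = n + x * p)%N ->
  let r := (alpha * p + beta * q)%N in
  shifted_mem p q r n k.+1 -> shifted_mem p q r m k.
Proof.
move=> p_gt0 le_mn r /shifted_memP[]// a [b nE]; apply/shifted_memP => //.
case: le_mn => [[le_x mE]|[le_y mE]].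
  exists (a + (alpha - x))%N, (b + beta + y)%N.
  apply: (@addIn (x * p)%N); rewrite mE nE /r.
  by move: (subnKC le_x); set d := (_ - x)%N => <-; ring.
exists (a + alpha + x)%N, (b + (beta - y))%N.
apply: (@addIn (y * q)%N); rewrite mE nE /r.
by move: (subnKC le_y); set d := (_ - y)%N => <-; ring.
Qed.

Lemma antitone_threshold (u : pred nat) :
    (forall k, u k.+1 -> u k) -> (exists k, ~~ u k) ->
  exists K, forall k, u k = (k < K)%N.
Proof.
move=> u_pred /ex_minnP[K uK minK]; exists K => k.
apply/idP/idP => [uk|]; last by apply: contraLR => /minK; rewrite -leqNgt.
rewrite ltnNge; apply: contra uK => /subnK kE; move: uk; rewrite -kE.
by elim: (k - K)%N => // d IH /u_pred.
Qed.

Lemma shifted_mem_threshold p q alpha beta n : (0 < p)%N ->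
    let r := (alpha * p + beta * q)%N in (0 < r)%N ->
  exists K, forall k, shifted_mem p q r n k = (k < K)%N.
Proof.
move=> p_gt0 r r_gt0; apply: antitone_threshold => [k|].
  (* No exchange: [m = n] and x = y = 0. *)
  by apply: (@shifted_mem_step _ _ _ _ 0 0) => //; left.
by exists n.+1; rewrite negb_and -ltnNge (leq_trans (ltnSn n)) // leq_pmull.
Qed.

Lemma excess_threshold p q r n K :
    (forall k, shifted_mem p q r n k = (k < K)%N) ->
  excess p q r n = (minn q K)%:Z - (minn q (K - p))%:Z.
Proof.
move=> uE; have count_lt m L : \sum_(k < m) ((k < L)%N)%:R = (minn m L)%:Z.
  rewrite -(big_mkord xpredT (fun k => ((k < L)%N)%:R)).
  elim: m => [|m IH]; first by rewrite big_nil min0n.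
  by rewrite big_nat_recr //= {}IH; lia.
rewrite /excess -!count_lt; congr (_ - _); apply: eq_bigr => k _.
  by rewrite uE.
by rewrite uE; congr (nat_of_bool _)%:R; lia.
Qed.

(** * Gaps of the semigroup, height and the Bezout relation *)

(** Here m = (alpha - x) p + (beta + y) q with a negative first coefficient and the second one below
    [p]. Any other representation changes the second by a multiple of [p], so both are never
    nonnegative. *)
Lemma notin_semigroup p q alpha beta x y m : (0 < p)%N -> coprime p q ->
    (alpha < x)%N -> (beta + y < p)%N ->
    (m + x * p = alpha * p + beta * q + y * q)%N ->
  ~~ in_semigroup p q m.
Proof.
move=> p_gt0 cpq lt_x lt_y mE; apply/in_semigroupP => // -[a [b mab]].
have pE : ((a + (x - alpha)) * p + b * q = (beta + y) * q)%N.
  by move: mE; rewrite mab -(subnKC (ltnW lt_x)) addKn; lia.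
have: (p %| beta + y - b)%N.
  by rewrite -(@Gauss_dvdl _ _ q) // mulnBl -pE addnK dvdn_mull.
rewrite gtnNdvd //; last by apply: leq_ltn_trans (leq_subr _ _) lt_y.
have: (b * q < (beta + y) * q)%N.
  rewrite -pE -[ltnLHS]add0n ltn_add2r muln_gt0 p_gt0.
  by rewrite addn_gt0 subn_gt0 lt_x orbT.
by rewrite ltn_mul2r subn_gt0 => /andP[].
Qed.

(** The leading coefficient of a nonzero integer polynomial already forces height at least 1. *)
Lemma flatP f : flat f <-> f != 0 /\ forall i, (`|(f`_i)%R| <= 1)%N.
Proof.
rewrite /flat /height; split=> [f1|[f_neq0 le_f1]].
  split=> [|i].
    apply: contra_eq_neq f1 => ->.
    by rewrite size_poly0 big_ord0.
  have [lt_i|le_i] := ltnP i (size f); last by rewrite nth_default.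
  by rewrite -f1 (leq_bigmax (Ordinal lt_i)).
apply/eqP; rewrite eqn_leq; apply/andP; split.
  by apply/bigmax_leqP => i _.
have lt_f : ((size f).-1 < size f)%N by rewrite prednK ?size_poly_gt0.
apply: leq_trans (leq_bigmax (Ordinal lt_f)) => /=.
by rewrite absz_gt0 -lead_coefE lead_coef_eq0.
Qed.

Lemma bezout_inverses p q p' q' : coprime p q ->
    (0 < p' < q)%N -> (0 < q' < p)%N ->
    p * p' = 1 %[mod q] -> q * q' = 1 %[mod p] ->
  (p * p' + q * q' = (p * q).+1)%N.
Proof.
move=> cpq /andP[p'_gt0 p'q] /andP[q'_gt0 q'p] p'_inv q'_inv.
have p_gt0 : (0 < p)%N by apply: leq_ltn_trans q'p.
have q_gt0 : (0 < q)%N by apply: leq_ltn_trans p'q.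
have : (p * q %| p * p' + q * q' - 1)%N.
  rewrite Gauss_dvd // -!eqn_mod_dvd ?addn_gt0 ?muln_gt0 ?p_gt0 ?p'_gt0 //.
  rewrite -modnDml modnMr add0n q'_inv eqxx /=.
  by rewrite -modnDmr modnMr addn0 p'_inv.
(* The multiple of [p * q] is positive and below [2 * p * q], so the quotient is 1. *)
case/dvdnP=> -[|[|k]]; nia.
Qed.

(** The hypotheses put the two thresholds within 1 of each other, and each minimum in D grows by 0
    or 1 when K grows by 1. *)
Lemma excess_step p q alpha beta m n : (0 < p)%N ->
    let r := (alpha * p + beta * q)%N in (0 < r)%N ->
    (forall k, shifted_mem p q r n k.+1 -> shifted_mem p q r m k) ->
    (forall k, shifted_mem p q r m k.+1 -> shifted_mem p q r n k) ->
  (`|(excess p q r m - excess p q r n)%R| <= 1)%N.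
Proof.
move=> p_gt0 r r_gt0 step_nm step_mn.
have [K uK] := @shifted_mem_threshold p q alpha beta m p_gt0 r_gt0.
have [L uL] := @shifted_mem_threshold p q alpha beta n p_gt0 r_gt0.
rewrite (excess_threshold uK) (excess_threshold uL).
have KL : (K <= L.+1)%N.
  case: K {uK} (uK) => [|[|K]] // uK.
  by have := step_mn K; rewrite -/r uK uL ltnSn => /(_ isT).
have LK : (L <= K.+1)%N.
  case: L {uL KL} (uL) => [|[|L]] // uL.
  by have := step_nm L; rewrite -/r uK uL ltnSn => /(_ isT).
lia.
Qed.

Local Close Scope ring_scope.

(** * The flatness criterion *)

(** Conditions (a) to (d) are the expansion of a conjunction of two disjunctions, one for each
    direction between n and n + 1. *)
Lemma geq_max_cases a b x y x' y' :
  [\/ maxn x x' <= a, maxn y y' <= b, x <= a /\ y' <= b | x' <= a /\ y <= b] <->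
  (x <= a \/ y <= b) /\ (x' <= a \/ y' <= b).
Proof.
rewrite !geq_max; split=> [[/andP[]|/andP[]|[]|[]]|[[] xy [] xy']]; try by auto.
- by constructor 1; apply/andP.
- by constructor 3.
- by constructor 4.
- by constructor 2; apply/andP.
Qed.

Theorem theorem2 (p q r alpha beta p' q' : nat)
  (p_prime : prime p) (q_prime : prime q) (r_prime : prime r)
  (p_odd : odd p) (q_odd : odd q) (r_odd : odd r)
  (lt_pq : p < q) (lt_qr : q < r)
  (alpha_gt0 : 0 < alpha) (beta_gt0 : 0 < beta)
  (r_def : r = alpha * p + beta * q)
  (r_le : r <= totient (p * q))
  (p'_range : 1 <= p' <= q - 1) (p'_inv : p * p' = 1 %[mod q])
  (q'_range : 1 <= q' <= p - 1) (q'_inv : q * q' = 1 %[mod p]) :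
  flat (inverse_cyclotomic (p * q * r)) <->
  [\/ maxn p' (q - p') <= alpha,
      maxn q' (p - q') <= beta,
      p' <= alpha /\ p - q' <= beta
    | q - p' <= alpha /\ q' <= beta].
Proof.
have p_gt0 := prime_gt0 p_prime; have p_gt1 := prime_gt1 p_prime.
have q_gt1 := prime_gt1 q_prime; have r_gt0 := prime_gt0 r_prime.
have pq : p != q by rewrite neq_ltn lt_pq.
have pr : p != r by rewrite neq_ltn (ltn_trans lt_pq).
have qr : q != r by rewrite neq_ltn lt_qr.
have cpq : coprime p q by rewrite prime_coprime // dvdn_prime2.
have bez : p * p' + q * q' = (p * q).+1.
  by apply: bezout_inverses => //; lia.
have p'E : p' * p = ((p - q') * q).+1.
  have: q' * q <= p * q by rewrite leq_mul2r; lia.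
  by rewrite mulnBl; lia.
have q'E : q' * q = ((q - p') * p).+1.
  have: p' * p <= q * p by rewrite leq_mul2r; lia.
  by rewrite mulnBl; lia.
have coef n := coef_inverse_cyclotomic_pqr n p_prime q_prime r_prime pq pr qr.
have excess0 : excess p q r 0 = 1%R.
  have u0 k : shifted_mem p q r 0 k = (k < 1).
    apply/shifted_memP/idP => // [[a [b /eqP]]|].
      rewrite eq_sym !addn_eq0 muln_eq0 -leqn0 leqNgt r_gt0 => /andP[/andP[]].
      by case: k.
    by case: k => // _; exists 0, 0; rewrite muln0.
  by rewrite (excess_threshold u0); lia.
(* K(r) = 2, from k = 0 and k = 1; as p >= 2, the second minimum vanishes. *)
have excess_r : excess p q r r = 2%R.
  have ur k : shifted_mem p q r r k = (k < 2).
    apply/shifted_memP/idP => // [[a [b rE]]|].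
      by rewrite ltnS -(leq_pmul2l r_gt0) muln1 [leqRHS]rE -addnA leq_addr.
    case: k => [|[|//]] _; first by exists alpha, beta; rewrite muln0.
    by exists 0, 0; rewrite muln1 !addn0.
  by rewrite (excess_threshold ur); lia.
(* As [r] is in the semigroup, m - r k in it would put [m] in it; so K(m) = 0. *)
have excess_notin m : ~~ in_semigroup p q m -> excess p q r m = 0%R.
  move=> mS; have um k : shifted_mem p q r m k = (k < 0).
    apply/shifted_memP => // -[a [b mE]]; case/in_semigroupP: mS => //.
    exists (k * alpha + a), (k * beta + b); rewrite mE r_def; ring.
  by rewrite (excess_threshold um); lia.
apply: iff_trans (iff_sym (geq_max_cases _ _ _ _ _ _)).
split=> [/flatP[_ coef_le1]|[forward backward]].
  split; apply/orP; apply: contraT; rewrite negb_or -!ltnNge => /andP[lta ltb].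
    (* r - 1 = (alpha - p') p + (beta + p - q') q; the coefficient at [r] is then -2. *)
    have mS : ~~ in_semigroup p q r.-1.
      apply: (@notin_semigroup p q alpha beta p' (p - q')) => //; first lia.
      by rewrite p'E -r_def; lia.
    have := coef_le1 r; rewrite coef excess_r excess_notin //.
    by case: eqP => [r0|//]; rewrite r0 in r_gt0.
  (* r + 1 = (alpha - (q - p')) p + (beta + q') q; the coefficient at [r.+1] is then 2. *)
  have mS : ~~ in_semigroup p q r.+1.
    apply: (@notin_semigroup p q alpha beta (q - p') q') => //; first lia.
    by rewrite q'E -r_def; lia.
  by have := coef_le1 r.+1; rewrite coef /= excess_r excess_notin.
(* The constant coefficient is -D(0) = -1, which also shows that the polynomial is nonzero. *)
apply/flatP; split=> [|[|n]].
- apply/eqP => /(congr1 (fun f : {poly int} => f`_0)%R).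
  by rewrite coef excess0 coef0.
- by rewrite coef excess0.
rewrite coef /= r_def; apply: excess_step => //; first by rewrite -r_def.
  (* The exchange lowers [n.+1] to [n]. *)
  move=> k; case: forward => le; apply: shifted_mem_step => //.
    by left; split; first exact: le; rewrite p'E addSnnS.
  by right; split; first exact: le; rewrite q'E addSnnS.
(* The exchange raises [n] to [n.+1]. *)
move=> k; case: backward => le; apply: shifted_mem_step => //.
  by left; split; first exact: le; rewrite addSnnS -q'E.
by right; split; first exact: le; rewrite addSnnS -p'E.
Qed.
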